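(* Let $T>0$, $N_t\in\mathbb{N}^*$, $\Delta t=T/N_t$ and $\Delta v>0$ satisfy $\Delta t\le\frac{\Delta v^2}{2}$. Let $\varphi_{\mathrm{in}}:\mathbb{R}\times\mathbb{R}\to\mathbb{R}$, let $\mu_{\mathrm{in}}(x)=\min_{j\in\mathbb{Z}}\varphi_{\mathrm{in}}(x-\Delta t\,v_j,v_j)$, and assume there exist $M>0$ and $L\ge0$ such that (a) $\left|\varphi_{\mathrm{in}}(x,v)-\frac{v^2}{2}\right|\le M$ for all $(x,v)\in\mathbb{R}^2$; (b) $\left|\mu_{\mathrm{in}}(x)+\varepsilon\ln(c^\varepsilon_{\Delta v})\right|\le M$ for all $x\in\mathbb{R}$ and all $\varepsilon\in(0,1]$; (c) for all $v\in\mathbb{R}$, $x\mapsto\varphi_{\mathrm{in}}(x,v)-\frac{v^2}{2}$ is $L$-Lipschitz. Then the solution $(\varphi_j^{N_t}(x))_{j\in\mathbb{Z}}$ of the semi-discrete scheme $(\mathcal{S}^0_{\Delta t,\Delta v})$ (defined in the context) satisfies, for all $x\in\mathbb{R}$ and $j\in\mathbb{Z}$, the discrete representation formula $$\varphi_j^{N_t}(x)=\inf_{\substack{\gamma=(y,\mathtt{w})\in\mathbb{R}\times(\Delta v\mathbb{Z})^{\{0,\dots,N_t\}}\\ \gamma(T)=x,\ w^{N_t}=v_j}}\left\{\varphi_{\mathrm{in}}(y,w^0)+\widetilde{A}_0^T[\gamma]\right\}.$$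
   Context: Discrete velocities $v_j=j\Delta v$, $j\in\mathbb{Z}$; $c^\varepsilon_{\Delta v}=\sum_{j\in\mathbb{Z}}e^{-v_j^2/(2\varepsilon)}\Delta v$. Scheme $(\mathcal{S}^0_{\Delta t,\Delta v})$: for $x\in\mathbb{R}$, $j\in\mathbb{Z}$, $0\le n\le N_t-1$, $$\mu^{n+1}(x)=\min_{j\in\mathbb{Z}}\varphi_j^n(x-\Delta t\,v_j),\qquad \varphi_j^{n+1}(x)=\min\left\{\varphi_j^n(x-\Delta t\,v_j)+\Delta t,\ \frac{v_j^2}{2}+\mu^{n+1}(x)\right\},$$ initialized with $\varphi_j^0(x)=\varphi_{\mathrm{in}}(x,v_j)$ and $\mu^0(x)=\mu_{\mathrm{in}}(x)$. Discrete paths: $\gamma=(y,\mathtt{w})$ with starting point $y\in\mathbb{R}$ and $\mathtt{w}=(w^0,\dots,w^{N_t})$, $w^k\in\Delta v\mathbb{Z}$; $w^k$ is the velocity on $[k\Delta t,(k+1)\Delta t)$ for $k\le N_t-1$ and $w^{N_t}$ is the velocity at time $T$. Positions on the time grid: $\gamma(n\Delta t)=y+\Delta t\sum_{k=1}^{n}w^{k-1}$; in particular $\gamma(T)=y+\Delta t\sum_{k=0}^{N_t-1}w^k$. Discrete action: $\widetilde{A}_0^T[\gamma]=\sum_{k=0}^{N_t-1}A_{w^k}^{w^{k+1}}$, where for $(v,w)\in\mathbb{R}^2$, $A_w^v=\Delta t\,\mathbf{1}_{v\neq0}$ if $v=w$, and $A_w^v=\frac{|v|^2}{2}$ if $v\neq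 w$. *)

(* Defs.v *)
From mathcomp Require Import all_boot all_order all_algebra.
From mathcomp Require Import all_classical all_reals all_analysis.
Set Implicit Arguments.
Unset Strict Implicit.
Unset Printing Implicit Defensive.
Import Order.TTheory GRing.Theory Num.Theory.
Import numFieldNormedType.Exports.
Local Open Scope classical_set_scope.
Local Open Scope ring_scope.

Definition velocity (R : realType) (dv : R) (j : int) : R := j%:~R * dv.

(* The sum over int converges for 0 < eps and 0 < dv, so [fine] loses
   nothing there. *)
Definition gauss_sum (R : realType) (dv eps : R) : R :=
  fine (\esum_(j in [set: int])
    (expR (- (velocity dv j ^+ 2 / (2 * eps))) * dv)%:E).

(* An attained minimum, not merely an infimum. *)
Definition is_min (R : realType) (A : set R) (m : R) : Prop :=
  A m /\ lbound A m.

(* [phi n j x] is phi_j^n(x) and [mu n x] is mu^n(x); the values at time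
   indices n > Nt are irrelevant. *)
Record scheme_solution (R : realType) (Nt : nat) (dt dv : R)
    (phi_in : R -> R -> R) (mu_in : R -> R)
    (phi : nat -> int -> R -> R) (mu : nat -> R -> R) : Prop := {
  scheme_phi0 : forall j x, phi 0%N j x = phi_in x (velocity dv j);
  scheme_mu0 : forall x, mu 0%N x = mu_in x;
  scheme_muS : forall n, (n < Nt)%N -> forall x,
    is_min [set phi n j (x - dt * velocity dv j) | j in [set: int]]
           (mu n.+1 x);
  scheme_phiS : forall n, (n < Nt)%N -> forall j x,
    phi n.+1 j x = Num.min (phi n j (x - dt * velocity dv j) + dt)
                           (velocity dv j ^+ 2 / 2 + mu n.+1 x)
}.

Record discrete_path (R : realType) (Nt : nat) (dv : R) := DiscretePath {
  path_start : R;
  path_velocity : 'I_Nt.+1 -> R;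
  path_velocity_grid : forall k, range (velocity dv) (path_velocity k)
}.

(* Position at time n * dt, meaningful for n <= Nt. *)
Definition path_position (R : realType) (Nt : nat) (dt dv : R)
    (g : discrete_path Nt dv) (n : nat) : R :=
  path_start g + dt * \sum_(1 <= k < n.+1) path_velocity g (inord k.-1).

(* The cost A_w^v of going from velocity w to velocity v. *)
Definition step_cost (R : realType) (dt w v : R) : R :=
  if v == w then dt * (v != 0)%:R else `|v| ^+ 2 / 2.

Definition discrete_action (R : realType) (Nt : nat) (dt dv : R)
    (g : discrete_path Nt dv) : R :=
  \sum_(0 <= k < Nt)
    step_cost dt (path_velocity g (inord k)) (path_velocity g (inord k.+1)).

(* Main.v *)
Require Import Defs.
From mathcomp Require Import all_boot all_order all_algebra.
From mathcomp Require Import all_classical all_reals all_analysis.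
From mathcomp Require Import ring lra.
Set Implicit Arguments.
Unset Strict Implicit.
Unset Printing Implicit Defensive.
Import Order.TTheory GRing.Theory Num.Theory.
Import numFieldNormedType.Exports.
Local Open Scope classical_set_scope.
Local Open Scope ring_scope.

(** The formula is the dynamic programming principle for a finite-horizon
    control problem.  Inserting the definition of mu^(n+1) into the update of
    phi^(n+1) shows that one step of the scheme is a minimization over the
    velocity v_i used during the step,
      phi_j^(n+1)(x) = min_i (phi_i^n(x - dt v_i) + c(i, j)),
    where c(i, j) = v_j^2 / 2 for i != j, and c(j, j) = min(dt, v_j^2 / 2)
    because velocity v_j may be kept at price dt or drawn anew at price
    v_j^2 / 2.  The condition dt <= dv^2 / 2 is exactly what identifies c with
    the step cost: a nonzero grid velocity satisfies v_j^2 / 2 >= dt, so that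
    keeping it costs dt, whereas the zero velocity is kept for free
    ([step_cost_velocity], [scheme_step_is_min]).  Iterating this one-step
    principle, an optimal path ending in (x, v_j) after n + 1 steps is an optimal
    path ending in (x - dt v_i, v_i) after n steps followed by one transition,
    whence the formula by induction ([scheme_is_min_path_cost]).  Each minimum
    over velocities in the scheme is attained, hence so is the infimum. *)

Lemma velocity_sqr_ge (R : realType) (dv : R) (j : int) :
  j != 0 -> dv ^+ 2 <= velocity dv j ^+ 2.
Proof.
move=> j0; rewrite /velocity exprMn ler_peMl ?sqr_ge0//.
by rewrite -rmorphXn/= ler1z -gtz0_ge1 exprn_even_gt0.
Qed.

Lemma velocity_eq (R : realType) (dv : R) (i j : int) : 0 < dv ->
  (velocity dv i == velocity dv j) = (i == j).
Proof. by move=> dv0; rewrite /velocity (inj_eq (mulIf (lt0r_neq0 dv0))) eqr_int. Qed.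

(** This is where the stability condition enters: it makes keeping a nonzero
    velocity no dearer than jumping to it, so that the cost of staying is the
    cheaper of the two options the scheme offers. *)
Lemma step_cost_velocity (R : realType) (dt dv : R) (i j : int) :
  0 <= dt -> 0 < dv -> dt <= dv ^+ 2 / 2 ->
  step_cost dt (velocity dv i) (velocity dv j) =
  if i == j then Num.min dt (velocity dv j ^+ 2 / 2)
  else velocity dv j ^+ 2 / 2.
Proof.
move=> dt0 dv0 dt_le; rewrite /step_cost velocity_eq// eq_sym.
case: eqP => _; last by rewrite real_normK ?num_real.
have -> : (velocity dv j != 0) = (j != 0).
  by rewrite -(velocity_eq j 0 dv0) {3}/velocity mul0r.
have [->|j0] := eqVneq j 0.
  by rewrite /velocity mul0r expr0n/= mul0r mulr0 min_r.
rewrite mulr1 min_l// (le_trans dt_le)// ler_wpM2r ?invr_ge0//.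
exact: velocity_sqr_ge.
Qed.

Lemma scheme_step_is_min (R : realType) (Nt : nat) (dt dv : R)
    (phi_in : R -> R -> R) (mu_in : R -> R)
    (phi : nat -> int -> R -> R) (mu : nat -> R -> R) :
  0 <= dt -> 0 < dv -> dt <= dv ^+ 2 / 2 ->
  scheme_solution Nt dt dv phi_in mu_in phi mu ->
  forall n, (n < Nt)%N -> forall j x,
  is_min [set phi n i (x - dt * velocity dv i)
              + step_cost dt (velocity dv i) (velocity dv j) | i in [set: int]]
         (phi n.+1 j x).
Proof.
move=> dt0 dv0 dt_le sol n nNt j x; rewrite (scheme_phiS sol nNt).
have [[i _ mu_i] mu_lb] := scheme_muS sol nNt x.
have mu_le k : mu n.+1 x <= phi n k (x - dt * velocity dv k).
  by apply: mu_lb; exists k.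
split=> [|_ [k _ <-]]; last first.
  rewrite step_cost_velocity//; have [->|_] := eqVneq k j.
    rewrite addr_minr le_min !ge_min lexx /=; apply/orP; right.
    by rewrite [leRHS]addrC lerD2l.
  by rewrite ge_min orbC [leRHS]addrC lerD2l mu_le.
have [keep|jump] := leP (phi n j (x - dt * velocity dv j) + dt)
                         (velocity dv j ^+ 2 / 2 + mu n.+1 x).
  exists j => //; rewrite step_cost_velocity// eqxx min_l//.
  by move: keep (mu_le j); lra.
exists i => //; rewrite step_cost_velocity//; have [ij|_] := eqVneq i j.
  by subst j; rewrite min_r; move: jump; rewrite -mu_i; lra.
by rewrite mu_i addrC.
Qed.

(** Prescribing the endpoint x determines the starting point, so a path is
    encoded by its velocity indices alone.  Only w 0, ..., w n matter: infinite
    sequences let all horizons n share one type, which the induction on n uses. *)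
Definition path_cost (R : realType) (dt dv : R) (phi_in : R -> R -> R)
    (n : nat) (w : nat -> int) (x : R) : R :=
  phi_in (x - dt * \sum_(0 <= k < n) velocity dv (w k)) (velocity dv (w 0%N))
  + \sum_(0 <= k < n)
      step_cost dt (velocity dv (w k)) (velocity dv (w k.+1)).

Lemma path_costS (R : realType) (dt dv : R) (phi_in : R -> R -> R)
    (n : nat) (w : nat -> int) (x : R) :
  path_cost dt dv phi_in n.+1 w x =
  path_cost dt dv phi_in n w (x - dt * velocity dv (w n))
  + step_cost dt (velocity dv (w n)) (velocity dv (w n.+1)).
Proof.
rewrite /path_cost !(big_nat_recr n)//= addrA; congr (phi_in _ _ + _ + _).
by rewrite mulrDr; ring.
Qed.

Lemma eq_path_cost (R : realType) (dt dv : R) (phi_in : R -> R -> R)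
    (n : nat) (w w' : nat -> int) (x : R) :
  (forall k, (k <= n)%N -> w k = w' k) ->
  path_cost dt dv phi_in n w x = path_cost dt dv phi_in n w' x.
Proof.
move=> ww'; rewrite /path_cost ww'//; congr (phi_in (_ - _ * _) _ + _).
  by apply: eq_big_nat => k /andP[_ kn]; rewrite ww'// ltnW.
by apply: eq_big_nat => k /andP[_ kn]; rewrite !ww'// ltnW.
Qed.

Lemma scheme_is_min_path_cost (R : realType) (Nt : nat) (dt dv : R)
    (phi_in : R -> R -> R) (mu_in : R -> R)
    (phi : nat -> int -> R -> R) (mu : nat -> R -> R) :
  0 <= dt -> 0 < dv -> dt <= dv ^+ 2 / 2 ->
  scheme_solution Nt dt dv phi_in mu_in phi mu ->
  forall n, (n <= Nt)%N -> forall j x,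
  is_min [set path_cost dt dv phi_in n w x | w in [set w | w n = j]]
         (phi n j x).
Proof.
move=> dt0 dv0 dt_le sol; elim=> [_ j x|n IH nNt j x].
  have cost0 w : path_cost dt dv phi_in 0 w x = phi_in x (velocity dv (w 0%N)).
    by rewrite /path_cost !big_nil mulr0 subr0 addr0.
  rewrite (scheme_phi0 sol); split=> [|_ [w /= <- <-]]; last by rewrite cost0.
  by exists (fun=> j) => //; rewrite cost0.
have [[i _ <-] step_lb] := scheme_step_is_min dt0 dv0 dt_le sol nNt j x.
have {}IH := IH (ltnW nNt).
split=> [|_ [w /= wj <-]]; last first.
  rewrite path_costS wj.
  apply: (le_trans (step_lb _ _)); first by exists (w n).
  by rewrite lerD2r; apply: (IH _ _).2; exists w.
have [[w /= wi <-] _] := IH i (x - dt * velocity dv i).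
(* Append j at time n + 1 to an optimal path for the previous state. *)
exists (fun k => if (k <= n)%N then w k else j); first by rewrite /= ltnn.
rewrite path_costS leqnn ltnn wi; congr (_ + _).
by apply: eq_path_cost => k ->.
Qed.

(** A choice of indices w for the velocities of g turns its endpoint into a
    formula for its starting point, and its total cost into a [path_cost]. *)
Lemma discrete_path_cost (R : realType) (Nt : nat) (dt dv : R)
    (phi_in : R -> R -> R) (g : discrete_path Nt dv) (w : nat -> int) :
  (forall k : 'I_Nt.+1, path_velocity g k = velocity dv (w k)) ->
  path_position dt g Nt
    = path_start g + dt * \sum_(0 <= k < Nt) velocity dv (w k) /\
  phi_in (path_start g) (path_velocity g ord0) + discrete_action dt g
    = path_cost dt dv phi_in Nt w (path_position dt g Nt).
Proof.
move=> gw.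
have gE k : (k <= Nt)%N -> path_velocity g (inord k) = velocity dv (w k).
  by move=> kNt; rewrite gw inordK.
have posE : path_position dt g Nt
    = path_start g + dt * \sum_(0 <= k < Nt) velocity dv (w k).
  rewrite /path_position big_add1; congr (_ + _ * _).
  by apply: eq_big_nat => k /andP[_ kNt]; rewrite /= gE// ltnW.
split=> //; rewrite /path_cost posE addrK gw; congr (_ + _).
by apply: eq_big_nat => k /andP[_ kNt]; rewrite !gE// ltnW.
Qed.

Theorem proposition4p14 (R : realType) (T dt dv : R) (Nt : nat)
    (phi_in : R -> R -> R) (mu_in : R -> R) (M L : R)
    (phi : nat -> int -> R -> R) (mu : nat -> R -> R)
    (T_gt0 : 0 < T) (Nt_gt0 : (0 < Nt)%N) (dtE : dt = T / Nt%:R)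
    (dv_gt0 : 0 < dv) (dt_le : dt <= dv ^+ 2 / 2)
    (mu_inE : forall x : R,
      is_min [set phi_in (x - dt * velocity dv j) (velocity dv j)
             | j in [set: int]] (mu_in x))
    (M_gt0 : 0 < M) (L_ge0 : 0 <= L)
    (phi_in_bound : forall x v : R, `|phi_in x v - v ^+ 2 / 2| <= M)
    (mu_in_bound : forall x eps : R, 0 < eps -> eps <= 1 ->
      `|mu_in x + eps * ln (gauss_sum dv eps)| <= M)
    (phi_in_lip : forall v : R,
      L.-lipschitz (fun x : R => phi_in x v - v ^+ 2 / 2))
    (phi_sol : scheme_solution Nt dt dv phi_in mu_in phi mu) :
  forall (x : R) (j : int),
    (phi Nt j x)%:E =
    ereal_inf [set (phi_in (path_start g) (path_velocity g ord0)
                    + discrete_action dt g)%:E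
              | g in [set g : discrete_path Nt dv |
                  path_position dt g Nt = x /\
                  path_velocity g ord_max = velocity dv j]].
Proof.
move=> x j.
have dt_ge0 : 0 <= dt by rewrite dtE divr_ge0 ?ler0n ?ltW.
have [[w /= wj phi_w] phi_lb] :=
  scheme_is_min_path_cost dt_ge0 dv_gt0 dt_le phi_sol (leqnn Nt) j x.
apply/eqP; rewrite eq_le; apply/andP; split.
  apply: le_ereal_inf_tmp => _ [g /= [gx gj] <-]; rewrite lee_fin.
  pose wg k := s2val (cid2 (path_velocity_grid g (inord k))).
  have gw (k : 'I_Nt.+1) : path_velocity g k = velocity dv (wg k).
    by rewrite /wg inord_val; case: cid2 => i /= _ ->.
  have [_ ->] := discrete_path_cost dt phi_in gw.
  rewrite gx; apply: phi_lb; exists wg => //=; apply/eqP.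
  by rewrite -(velocity_eq _ _ dv_gt0) -gj gw.
have on_grid (k : 'I_Nt.+1) : range (velocity dv) (velocity dv (w k)).
  by exists (w k).
pose g := DiscretePath (x - dt * \sum_(0 <= k < Nt) velocity dv (w k)) on_grid.
have [posE costE] :=
  discrete_path_cost (g := g) (w := w) dt phi_in (fun=> erefl).
have gx : path_position dt g Nt = x by rewrite posE subrK.
apply: ereal_inf_lbound; exists g; first by rewrite /= gx wj.
by rewrite costE gx phi_w.
Qed.
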